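(* Let $\mathfrak{g}$ be an integrable LCK Lie algebra with Lee vector $U$ and anti-Lee vector $V$, and let $\mathfrak{h}=\langle U,V\rangle^\perp$. Then $\mathfrak{g}\cong\langle U,V\rangle\ltimes_\rho\mathfrak{h}$ as Lie algebras, where $\rho(U)=\mathrm{ad}_U|_{\mathfrak{h}}$ and $\rho(V)=\mathrm{ad}_V|_{\mathfrak{h}}$.
   Context: Lie algebras are real and finite-dimensional; for $\alpha\in\mathfrak{g}^*$ the Chevalley-Eilenberg differential satisfies $d\alpha(X,Y)=-\alpha([X,Y])$, and for a $2$-form $\Omega$, $d\Omega(X,Y,Z)=-\Omega([X,Y],Z)-\Omega([Y,Z],X)-\Omega([Z,X],Y)$. An LCK structure on a Lie algebra $\mathfrak{g}$ of dimension $2n+2$ ($n\ge1$) consists of a positive definite inner product $g$, an endomorphism $J$ with $J^2=-\mathrm{Id}$ and $N_J(X,Y)=[JX,JY]-[X,Y]-J[JX,Y]-J[X,JY]=0$ for all $X,Y$, such that $\Omega(X,Y)=g(X,JY)$ is a $2$-form, and $1$-forms $\theta,\eta\in\mathfrak g^*$ with $d\Omega=\theta\wedge\Omega$, $d\theta=0$, and $\eta(X)=-\theta(JX)$. The Lee vector $U$ and anti-Lee vector $V$ are the metric duals of $\theta$ and $\eta$ (so $V=JU$). By rescaling the metric it is always assumed that $|\theta|=1$. The LCK Lie algebra is integrable if $\eta\wedge d\eta=0$. Given Lie algebras $\mathfrak g_1,\mathfrak g_2$ and a homomorphism $\rho$ from $\mathfrak g_1$ to the derivations of $\mathfrak g_2$,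 the semidirect product $\mathfrak g_1\ltimes_\rho\mathfrak g_2$ is $\mathfrak g_1\oplus\mathfrak g_2$ with bracket $[(a_1,b_1),(a_2,b_2)]=([a_1,a_2],\rho(a_1)b_2-\rho(a_2)b_1+[b_1,b_2])$. The statement includes that $\langle U,V\rangle$ is a Lie subalgebra and that $\mathfrak h$ is an ideal. *)

(* Defs.v *)
From HB Require Import structures.
From mathcomp Require Import all_boot all_order all_algebra.
From mathcomp Require Import ring reals.

Set Implicit Arguments.
Unset Strict Implicit.
Unset Printing Implicit Defensive.

Import Order.TTheory GRing.Theory Num.Theory.
Local Open Scope ring_scope.

HB.mixin Record Vector_isLieAlgebra (R : fieldType) (L : Type)
    of Vector R L := {
  lie : L -> L -> L;
  lie_bilinear : bilinear_for *:%R *:%R lie;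
  liexx : forall x, lie x x = 0;
  lie_jacobi : forall x y z,
    lie x (lie y z) + lie y (lie z x) + lie z (lie x y) = 0
}.

#[short(type="lieAlgType")]
HB.structure Definition LieAlgebra (R : fieldType) :=
  { L of Vector_isLieAlgebra R L & Vector R L }.

Notation "[lie x , y ]" := (lie x y)
  (at level 0, x at level 99, y at level 99, format "[lie  x ,  y ]")
  : ring_scope.

Section LieTheory.
Variables (R : fieldType) (L : lieAlgType R).
Implicit Types (x y z : L) (a : R).

Lemma lieDl x y z : [lie x + y, z] = [lie x, z] + [lie y, z].
Proof. by have /= := (@lie_bilinear _ L).1 z 1 x y; rewrite !scale1r. Qed.

Lemma lieDr x y z : [lie z, x + y] = [lie z, x] + [lie z, y].
Proof. by have /= := (@lie_bilinear _ L).2 z 1 x y; rewrite !scale1r. Qed.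

Lemma lie0l x : [lie 0, x] = 0.
Proof. by apply: (addIr [lie 0, x]); rewrite -lieDl !add0r. Qed.

Lemma lie0r x : [lie x, 0] = 0.
Proof. by apply: (addIr [lie x, 0]); rewrite -lieDr !add0r. Qed.

Lemma lieZl a x z : [lie a *: x, z] = a *: [lie x, z].
Proof.
by have /= := (@lie_bilinear _ L).1 z a x 0; rewrite addr0 lie0l addr0.
Qed.

Lemma lieZr a x z : [lie z, a *: x] = a *: [lie z, x].
Proof.
by have /= := (@lie_bilinear _ L).2 z a x 0; rewrite addr0 lie0r addr0.
Qed.

Lemma lieNl x z : [lie - x, z] = - [lie x, z].
Proof. by rewrite -!scaleN1r lieZl. Qed.

Lemma lieNr x z : [lie z, - x] = - [lie z, x].
Proof. by rewrite -!scaleN1r lieZr. Qed.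

Lemma lieC x y : [lie x, y] = - [lie y, x].
Proof.
apply/eqP; rewrite -addr_eq0; apply/eqP.
by have := liexx (x + y); rewrite lieDl !lieDr !liexx add0r addr0.
Qed.

End LieTheory.

Definition lie_isomorphic (R : fieldType) (L1 L2 : lieAlgType R) : Prop :=
  exists2 f : 'Hom(L1, L2),
    bijective f & forall x y, f [lie x, y] = [lie f x, f y].

Definition is_subalgebra (R : fieldType) (L : lieAlgType R)
    (A : {vspace L}) : Prop :=
  {in A &, forall x y, [lie x, y] \in A}.

Definition is_ideal (R : fieldType) (L : lieAlgType R)
    (A : {vspace L}) : Prop :=
  forall x y, y \in A -> [lie x, y] \in A.

Lemma ideal_subalgebra (R : fieldType) (L : lieAlgType R) (A : {vspace L}) :
  is_ideal A -> is_subalgebra A.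
Proof. by move=> idA x y _; apply: idA. Qed.

(* [subA] is a (phantom) parameter of the type so that the Lie algebra
   structure on it is inferred. *)
Definition subalgebra_of (R : fieldType) (L : lieAlgType R) (A : {vspace L})
  (subA : is_subalgebra A) : Type := subvs_of A.

Section Subalgebra.
Variables (R : fieldType) (L : lieAlgType R) (A : {vspace L}).
Variable subA : is_subalgebra A.
Local Notation S := (subalgebra_of subA).

HB.instance Definition _ := Vector.copy S (subvs_of A).

Definition sub_lie (x y : S) : S :=
  Subvs (subA (subvsP (x : subvs_of A)) (subvsP (y : subvs_of A))).

Fact sub_lie_bilinear : bilinear_for *:%R *:%R sub_lie.
Proof.
split=> [z a x y | z a x y]; apply: val_inj => /=.
  by rewrite lieDl lieZl.
by rewrite lieDr lieZr.
Qed.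

Fact sub_liexx x : sub_lie x x = 0.
Proof. by apply: val_inj; rewrite /= liexx. Qed.

Fact sub_lie_jacobi x y z :
  sub_lie x (sub_lie y z) + sub_lie y (sub_lie z x)
    + sub_lie z (sub_lie x y) = 0.
Proof. by apply: val_inj; rewrite /= lie_jacobi. Qed.

HB.instance Definition _ := Vector_isLieAlgebra.Build R S
  sub_lie_bilinear sub_liexx sub_lie_jacobi.

End Subalgebra.

Definition is_derivation (R : fieldType) (L : lieAlgType R)
    (D : 'End(L)) : Prop :=
  forall x y, D [lie x, y] = [lie D x, y] + [lie x, D y].

(* Lie algebra homomorphisms L1 -> Der(L2), the bracket on Der(L2) being the
   commutator. *)
Record der_hom (R : fieldType) (L1 L2 : lieAlgType R) := DerHom {
  der_hom_fun :> 'Hom(L1, 'End(L2));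
  der_hom_derivation : forall a, is_derivation (der_hom_fun a);
  der_hom_lie : forall a b, der_hom_fun [lie a, b] =
    (der_hom_fun a \o der_hom_fun b)%VF - (der_hom_fun b \o der_hom_fun a)%VF
}.

Definition semidirect (R : fieldType) (L1 L2 : lieAlgType R)
  (rho : der_hom L1 L2) : Type := (L1 * L2)%type.

Section Semidirect.
Variables (R : fieldType) (L1 L2 : lieAlgType R) (rho : der_hom L1 L2).
Local Notation P := (semidirect rho).

HB.instance Definition _ := Vector.copy P (L1 * L2)%type.

Definition semidirect_lie (x y : P) : P :=
  ([lie x.1, y.1], rho x.1 y.2 - rho y.1 x.2 + [lie x.2, y.2]).

Let semidirect_eq (u v : P) : u.1 = v.1 -> u.2 = v.2 -> u = v.
Proof. by case: u v => [? ?] [? ?] /= -> ->. Qed.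

Fact semidirect_lie_bilinear : bilinear_for *:%R *:%R semidirect_lie.
Proof.
split=> [z a x y | z a x y]; apply: semidirect_eq => /=;
  rewrite ?lieDl ?lieDr ?lieZl ?lieZr // !(linearP, add_lfunE, scale_lfunE) /=.
all: rewrite !scalerDr scalerN ?opprD [RHS]addrACA; congr (_ + _).
all: by rewrite [RHS]addrACA.
Qed.

Fact semidirect_liexx x : semidirect_lie x x = 0.
Proof. by rewrite /semidirect_lie !liexx subrr addr0. Qed.

Fact semidirect_lie_jacobi x y z :
  semidirect_lie x (semidirect_lie y z) + semidirect_lie y (semidirect_lie z x)
    + semidirect_lie z (semidirect_lie x y) = 0.
Proof.
case: x y z => [x1 x2] [y1 y2] [z1 z2]; apply: semidirect_eq => /=.
  exact: lie_jacobi.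
rewrite !der_hom_lie !(linearD, linearB) /= !der_hom_derivation.
rewrite !lieDr !lieNr !(add_lfunE, opp_lfunE, comp_lfunE, linearN).
have jac : [lie z2, [lie x2, y2]] =
           - ([lie x2, [lie y2, z2]] + [lie y2, [lie z2, x2]]).
  by apply/eqP; rewrite -addr_eq0 addrC lie_jacobi.
rewrite jac (lieC z2 (rho x1 y2)) (lieC z2 (rho y1 x2)) (lieC y2 (rho z1 x2)).
rewrite (lieC x2 (rho y1 z2)).
(* The remaining identity is in the additive group L2: check it on the
   coordinates, which lie in R. *)
rewrite /= !opprD !opprK; set w : L2 := (X in X = _).
rewrite (coord_vbasis (memvf w)) big1 // => i _.
suff -> : coord (vbasis fullv) i w = 0 by rewrite scale0r.
have cD u v : coord (vbasis fullv) i (u + v : L2) =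
    coord (vbasis fullv) i u + coord (vbasis fullv) i v by exact: linearD.
have cN u : coord (vbasis fullv) i (- u : L2) = - coord (vbasis fullv) i u
  by exact: linearN.
rewrite /w !(cD, cN).
by ring.
Qed.

HB.instance Definition _ := Vector_isLieAlgebra.Build R P
  semidirect_lie_bilinear semidirect_liexx semidirect_lie_jacobi.

End Semidirect.

Section Forms.
Variables (R : fieldType) (L : lieAlgType R).

Definition is_2form (w : L -> L -> R) : Prop :=
  bilinear_for *%R *%R w /\ forall x, w x x = 0.

Definition ce_d1 (alpha : 'Hom(L, R^o)) (x y : L) : R := - alpha [lie x, y].

Definition ce_d2 (w : L -> L -> R) (x y z : L) : R :=
  - w [lie x, y] z - w [lie y, z] x - w [lie z, x] y.

(* Wedge product in the normalization matching [ce_d1] and [ce_d2] (sum over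
   shuffles, no 1/(p+q)! factor), simplified using that [w] is alternating. *)
Definition wedge12 (alpha : 'Hom(L, R^o)) (w : L -> L -> R) (x y z : L) : R :=
  alpha x * w y z + alpha y * w z x + alpha z * w x y.

Definition nijenhuis (J : 'End(L)) (x y : L) : L :=
  [lie J x, J y] - [lie x, y] - J [lie J x, y] - J [lie x, J y].

End Forms.

Section Metric.
Variables (R : realType) (V : vectType R) (g : {dot V for idfun}).

Definition flat (x : V) : 'Hom(V, R^o) := linfun (g x : V -> R^o).

Definition sharp (alpha : 'Hom(V, R^o)) : V := ((linfun flat)^-1)%VF alpha.

Fact flat_linear : linear flat.
Proof.
move=> a x y; apply/lfunP => z; rewrite !(add_lfunE, scale_lfunE, lfunE) /=.
by rewrite linearPl.
Qed.

HB.instance Definition _ := GRing.isLinear.Build R V 'Hom(V, R^o) *:%R flat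
  flat_linear.

Lemma sharpP alpha x : g (sharp alpha) x = alpha x.
Proof.
suff: flat (sharp alpha) = alpha by move/lfunP/(_ x); rewrite lfunE.
have kerf : lker (linfun flat) == 0%VS.
  apply/lker0P => u v; rewrite !lfunE /= => /lfunP/(_ (u - v)).
  rewrite !lfunE /= => guv; apply/eqP; rewrite -subr_eq0.
  apply: contraT => uv_neq0; have := neq0_dnorm_gt0 (s := g) _ uv_neq0.
  by have /= -> := linearBl g (u - v) u v; rewrite guv subrr ltxx.
have imf : (limg (linfun flat) = fullv)%VS.
  apply/eqP; rewrite eqEdim subvf /= limg_dim_eq; last first.
    by rewrite (eqP kerf) capv0.
  by rewrite !dimvf /dim /= muln1.
by rewrite -[LHS](lfunE flat) limg_lfunVK ?imf ?memvf.
Qed.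

Definition mnorm (x : V) : R := Num.sqrt (g x x).

(* Norm of a covector for the inner product transported by [sharp]. *)
Definition conorm (alpha : 'Hom(V, R^o)) : R := mnorm (sharp alpha).

End Metric.

Definition fundamental_form (R : realType) (L : lieAlgType R)
  (g : {dot L for idfun}) (J : 'End(L)) (x y : L) : R := g x (J y).

Record lck_structure (R : realType) (L : lieAlgType R) := LCKStructure {
  lck_metric : {dot L for idfun};
  lck_J : 'End(L);
  lee_form : 'Hom(L, R^o);
  anti_lee_form : 'Hom(L, R^o);
  lck_JJ : forall x, lck_J (lck_J x) = - x;
  lck_nijenhuis : forall x y, nijenhuis lck_J x y = 0;
  lck_2form : is_2form (fundamental_form lck_metric lck_J);
  lck_dOmega : forall x y z,
    ce_d2 (fundamental_form lck_metric lck_J) x y z =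
    wedge12 lee_form (fundamental_form lck_metric lck_J) x y z;
  lck_dlee : forall x y, ce_d1 lee_form x y = 0;
  anti_leeE : forall x, anti_lee_form x = - lee_form (lck_J x)
}.

Section LCK.
Variables (R : realType) (L : lieAlgType R) (S : lck_structure L).

Definition lee_vector : L := sharp (lck_metric S) (lee_form S).
Definition anti_lee_vector : L := sharp (lck_metric S) (anti_lee_form S).

Definition lck_integrable : Prop := forall x y z,
  wedge12 (anti_lee_form S) (ce_d1 (anti_lee_form S)) x y z = 0.

End LCK.

(* Main.v *)
From HB Require Import structures.
Require Import Defs.
From mathcomp Require Import all_boot all_order all_algebra.
From mathcomp Require Import reals.
Set Implicit Arguments.
Unset Strict Implicit.
Unset Printing Implicit Defensive.

Import Order.TTheory GRing.Theory Num.Theory.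
Local Open Scope ring_scope.

(** A Lie algebra that is the direct sum, as a vector space, of a subalgebra
    [A] and an ideal [B] is the semidirect product of [A] and [B] for the
    adjoint action (lemma [isomorphic_semidirect]).  So the point is that
    [K = <U, V>] is a subalgebra and that its orthogonal complement [h], which
    is the common kernel of [theta] and [eta] and is stable under [J], is an
    ideal.

    Since [theta] is closed, it vanishes on all brackets; membership of a
    bracket in [h] is thus decided by [eta] alone.  Contracting
    [eta /\ d eta = 0] with [V], where [eta V = 1], shows that [eta] also
    vanishes on brackets of two elements of [ker eta]
    ([anti_lee_lie_ker]).  This settles all brackets with [h] except those
    with [V], and there the integrability of [J] helps: for [y] in [h],
    applying [theta] to [N_J (U, y) = 0] leaves
    [eta [V, y] + eta [U, J y] = 0], whose second term is zero because [U] and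
    [J y] lie in [ker eta] ([anti_lee_lie_V]).  Hence [h] is an ideal.

    For [K], the bracket [[U, V]] is killed by [theta], so it is a multiple of
    [V] plus some [W] in [h].  Evaluating [d Omega = theta /\ Omega] on
    [U], [V] and [z] in [h], every term but [Omega ([U, V], z)] vanishes; hence
    [g W (J z) = 0] for all [z] in [h], and [z = J W] gives [W = 0]
    ([lie_lee_anti_lee]). *)

(** * Internal semidirect products *)

Lemma daddv_pi_eq0 (F : fieldType) (T : vectType F) (A B : {vspace T}) x :
  (A :&: B = 0)%VS -> x \in B -> daddv_pi A B x = 0.
Proof.
move=> AB0 xB; have BA0 : (B :&: A = 0)%VS by rewrite capvC.
have := daddv_pi_add AB0 (subvP (addvSr A B) x xB).
by rewrite (daddv_pi_id BA0 xB) => /(canRL (addrK _)); rewrite subrr.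
Qed.

Section AdjointAction.
Variables (R : fieldType) (L : lieAlgType R) (A B : {vspace L}).
Variables (subA : is_subalgebra A) (idB : is_ideal B).
Local Notation SA := (subalgebra_of subA).
Local Notation SB := (subalgebra_of (ideal_subalgebra idB)).

Definition ideal_ad_fun (x : L) (y : SB) : SB :=
  Subvs (idB x (subvsP (y : subvs_of B))).

Fact ideal_ad_fun_linear x : linear (ideal_ad_fun x).
Proof. by move=> a y z; apply: val_inj; rewrite /= lieDr lieZr. Qed.

HB.instance Definition _ (x : L) := GRing.isLinear.Build R SB SB *:%R
  (ideal_ad_fun x) (ideal_ad_fun_linear x).

Definition ideal_ad (x : SA) : 'End(SB) :=
  linfun (ideal_ad_fun (vsval (x : subvs_of A))).

Lemma val_ideal_ad x (y : SB) :
  vsval (ideal_ad x y : subvs_of B) =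
  [lie vsval (x : subvs_of A), vsval (y : subvs_of B)].
Proof. by rewrite lfunE. Qed.

Fact ideal_ad_linear : linear ideal_ad.
Proof.
move=> a x y; apply/lfunP => z; rewrite add_lfunE scale_lfunE; apply: val_inj.
rewrite [LHS]val_ideal_ad /= lieDl lieZl; congr (_ *: _ + _).
  exact/esym/val_ideal_ad.
exact/esym/val_ideal_ad.
Qed.

HB.instance Definition _ := GRing.isLinear.Build R SA 'End(SB) *:%R ideal_ad
  ideal_ad_linear.

(** The Jacobi identity in the form that says that [ad x] is a derivation and
    that [ad] is a homomorphism. *)
Lemma lie_leibniz (x y z : L) :
  [lie x, [lie y, z]] = [lie [lie x, y], z] + [lie y, [lie x, z]].
Proof.
have := lie_jacobi x y z; rewrite (lieC z x) lieNr (lieC z [lie x, y]).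
by move/eqP; rewrite -addrA -opprD subr_eq0 addrC => /eqP.
Qed.

Fact ideal_ad_derivation x : is_derivation (linfun ideal_ad x).
Proof.
move=> y z; rewrite lfunE; apply: val_inj; rewrite [LHS]val_ideal_ad /=.
by rewrite !val_ideal_ad lie_leibniz.
Qed.

Fact ideal_ad_lie x y : linfun ideal_ad [lie x, y] =
  (linfun ideal_ad x \o linfun ideal_ad y)%VF
  - (linfun ideal_ad y \o linfun ideal_ad x)%VF.
Proof.
apply/lfunP => z; rewrite add_lfunE opp_lfunE !comp_lfunE [linfun _ _]lfunE.
rewrite [linfun _ x]lfunE [linfun _ y]lfunE; apply: val_inj.
by rewrite [LHS]val_ideal_ad /= !val_ideal_ad lie_leibniz addrK.
Qed.

Definition adjoint_action : der_hom SA SB :=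
  DerHom ideal_ad_derivation ideal_ad_lie.

Lemma adjoint_actionE (x : L) (y : SB) : x \in A ->
  vsval (adjoint_action (vsproj A x) y : subvs_of B)
  = [lie x, vsval (y : subvs_of B)].
Proof. by move=> xA; rewrite /= lfunE /= val_ideal_ad vsprojK. Qed.

Section Splitting.
Hypotheses (AB0 : (A :&: B = 0)%VS) (ABT : (A + B = fullv)%VS).
Local Notation P := (semidirect adjoint_action).

Let BA0 : (B :&: A = 0)%VS. Proof. by rewrite capvC. Qed.

(** [vsproj] alone projects along an arbitrary complement, hence the
    preliminary projection along the other summand. *)
Definition split_fun (x : L) : P :=
  (vsproj A (daddv_pi A B x), vsproj B (daddv_pi B A x)).

Definition merge_fun (u : P) : L :=
  vsval (u.1 : subvs_of A) + vsval (u.2 : subvs_of B).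

Fact split_fun_linear : linear split_fun.
Proof. by move=> a x y; rewrite /split_fun !linearP. Qed.

HB.instance Definition _ := GRing.isLinear.Build R L P *:%R split_fun
  split_fun_linear.

Lemma split_funK : cancel split_fun merge_fun.
Proof.
move=> x; rewrite /merge_fun /= !vsprojK ?memv_pi //.
by rewrite daddv_pi_add // ABT memvf.
Qed.

Lemma merge_funK : cancel merge_fun split_fun.
Proof.
move=> [a b]; rewrite /split_fun /merge_fun /= !linearD /=.
rewrite (daddv_pi_id AB0 (subvsP a)) (daddv_pi_id BA0 (subvsP b)).
rewrite (daddv_pi_eq0 AB0 (subvsP b)).
rewrite (daddv_pi_eq0 BA0 (subvsP a)).
by rewrite !linear0 addr0 add0r !vsvalK.
Qed.

(** The bracket of the semidirect product is designed to be that of the sums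
    [a + b]: expanding [[a + b, a' + b']] gives the cross terms [[a, b']] and
    [[b, a'] = - [a', b]]. *)
Lemma merge_fun_lie u v :
  merge_fun [lie u, v] = [lie merge_fun u, merge_fun v].
Proof.
rewrite /merge_fun /= [linfun _ u.1]lfunE [linfun _ v.1]lfunE !val_ideal_ad.
by rewrite lieDl !lieDr (lieC (vsval v.1)) opprK -!addrA.
Qed.

Lemma isomorphic_semidirect : lie_isomorphic L P.
Proof.
have fE x : linfun split_fun x = split_fun x by exact: lfunE.
exists (linfun split_fun) => [|x y].
  exact: eq_bij (Bijective split_funK merge_funK) _ (fsym fE).
rewrite !fE; apply: (can_inj merge_funK).
by rewrite merge_fun_lie !split_funK.
Qed.

End Splitting.
End AdjointAction.

(** * Inner products *)

Section InnerProduct.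
Variables (R : realType) (T : vectType R) (g : {dot T for idfun}).

Lemma metricC x y : g x y = g y x.
Proof. by rewrite hermC expr0 mul1r. Qed.

Lemma metric_eq0 x : g x x = 0 -> x = 0.
Proof.
move=> gxx0; apply/eqP; apply: contraT => x_neq0.
by have := neq0_dnorm_gt0 (s := g) _ x_neq0; rewrite gxx0 ltxx.
Qed.

Lemma metric_inj x y : (forall z, g x z = g y z) -> x = y.
Proof.
move=> gxy; apply/eqP; rewrite -subr_eq0; apply/eqP/metric_eq0.
by have /= -> := linearBl g (x - y) x y; rewrite gxy subrr.
Qed.

Lemma metric_ge0 x : 0 <= g x x.
Proof.
have [-> | x_neq0] := eqVneq x 0; first by rewrite linear0r.
exact/ltW/neq0_dnorm_gt0.
Qed.

Lemma capv_orthov (K : {vspace T}) : (K :&: orthov g K = 0)%VS.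
Proof.
apply/eqP; rewrite -subv0; apply/subvP => x; rewrite memv_cap memv0.
by case/andP => xK /mem_orthovP/(_ x xK)/metric_eq0/eqP.
Qed.

End InnerProduct.

(** * Integrable locally conformally Kaehler Lie algebras *)

Section IntegrableLCK.
Variables (R : realType) (L : lieAlgType R) (S : lck_structure L).
Hypotheses (lee_unit : conorm (lck_metric S) (lee_form S) = 1)
  (integrableS : lck_integrable S).
Local Notation g := (lck_metric S).
Local Notation J := (lck_J S).
Local Notation theta := (lee_form S).
Local Notation eta := (anti_lee_form S).
Local Notation U := (lee_vector S).
Local Notation V := (anti_lee_vector S).
Local Notation K := <<[:: U; V]>>%VS.
Local Notation h := (orthov g K).

(** [Omega] being a 2-form means that [J] is skew for the metric. *)
Lemma metricJC x y : g x (J y) = - g y (J x).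
Proof.
have [_ alt] := lck_2form S; rewrite /fundamental_form in alt.
apply/eqP; rewrite -addr_eq0; apply/eqP; have := alt (x + y).
by rewrite linearD linearDl !linearDr /= !alt add0r addr0.
Qed.

Lemma lee_vectorE x : g U x = theta x. Proof. exact: sharpP. Qed.
Lemma anti_lee_vectorE x : g V x = eta x. Proof. exact: sharpP. Qed.

Lemma lee_lie x y : theta [lie x, y] = 0.
Proof. by apply/eqP; rewrite -oppr_eq0; apply/eqP/(lck_dlee S). Qed.

Lemma anti_leeJ x : eta (J x) = theta x.
Proof. by rewrite anti_leeE lck_JJ linearN opprK. Qed.

Lemma leeJ x : theta (J x) = - eta x.
Proof. by rewrite anti_leeE opprK. Qed.

Lemma J_lee_vector : J U = V.
Proof.
apply: (metric_inj (g := g)) => x; rewrite anti_lee_vectorE metricC metricJC.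
by rewrite lee_vectorE anti_leeE.
Qed.

Lemma J_anti_lee_vector : J V = - U.
Proof. by rewrite -J_lee_vector lck_JJ. Qed.

Lemma lee_U : theta U = 1.
Proof.
have := lee_unit; rewrite /conorm /mnorm -/(lee_vector S) lee_vectorE.
have th_ge0 : 0 <= theta U by rewrite -lee_vectorE metric_ge0.
by move=> sqrt1; rewrite -[theta U]sqr_sqrtr // sqrt1 expr1n.
Qed.

Lemma anti_lee_V : eta V = 1.
Proof. by rewrite -J_lee_vector anti_leeJ lee_U. Qed.

Lemma anti_lee_U : eta U = 0.
Proof.
have [_ alt] := lck_2form S.
by rewrite anti_leeE -lee_vectorE [g _ _]alt oppr0.
Qed.

Lemma lee_V : theta V = 0.
Proof. by rewrite -J_lee_vector leeJ anti_lee_U oppr0. Qed.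

Lemma lee_vector_in_K : U \in K.
Proof. by apply: memv_span; rewrite !inE eqxx. Qed.

Lemma anti_lee_vector_in_K : V \in K.
Proof. by apply: memv_span; rewrite !inE eqxx orbT. Qed.

Lemma memK_comb x : x \in K -> exists a b, x = a *: U + b *: V.
Proof.
rewrite span_cons span_seq1 => /memv_addP[_ /vlineP[a ->] [_ /vlineP[b ->] ->]].
by exists a, b.
Qed.

Lemma mem_hP x : reflect (theta x = 0 /\ eta x = 0) (x \in h).
Proof.
apply: (iffP mem_orthovP) => [xK | [thx etax] y].
  rewrite -lee_vectorE -anti_lee_vectorE !(metricC g _ x).
  by split; apply: xK; rewrite (lee_vector_in_K, anti_lee_vector_in_K).
case/memK_comb=> a [b ->].
rewrite [LHS]metricC linearDl /= !linearZl_LR /= lee_vectorE anti_lee_vectorE.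
by rewrite thx etax !mulr0 addr0.
Qed.

Lemma hJ x : x \in h -> J x \in h.
Proof.
by case/mem_hP=> thx etax; apply/mem_hP; rewrite leeJ anti_leeJ thx etax oppr0.
Qed.

Lemma sub_projection_mem_h x : x - (theta x *: U + eta x *: V) \in h.
Proof.
apply/mem_hP; rewrite !linearB !linearD !linearZ /= lee_U lee_V.
rewrite anti_lee_U anti_lee_V.
by rewrite oppr0 !scaler0 !scalerN ![_ *: 1]mulr1 addr0 add0r !subrr.
Qed.

Lemma addv_Kh : (K + h = fullv)%VS.
Proof.
apply/eqP; rewrite eqEsubv subvf; apply/subvP => x _.
rewrite -[x](addrNK (theta x *: U + eta x *: V)) addrC memv_add //.
  by rewrite memvD // memvZ // (lee_vector_in_K, anti_lee_vector_in_K).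
exact: sub_projection_mem_h.
Qed.

(** Contracting [eta /\ d eta = 0] with [V] expresses [d eta (x, y)] through
    [eta x] and [eta y]; so [ker eta] is a subalgebra. *)
Lemma anti_lee_lie_ker x y : eta x = 0 -> eta y = 0 -> eta [lie x, y] = 0.
Proof.
move=> etax etay; have := integrableS V x y; rewrite /wedge12 /ce_d1.
rewrite anti_lee_V etax etay !mul0r !addr0 mul1r => /eqP.
by rewrite oppr_eq0 => /eqP.
Qed.

(** The only bracket with [h] that the previous lemma does not control.
    Vanishing of the [theta] component of [N_J (U, y)], in which
    [theta \o J = - eta] and [J U = V], trades it for [eta [U, J y]], where
    both arguments are in [ker eta]. *)
Lemma anti_lee_lie_V y : y \in h -> eta [lie V, y] = 0.
Proof.
move=> yh; have /mem_hP[thy etay] := yh; have /mem_hP[_ etaJy] := hJ yh.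
have := congr1 theta (lck_nijenhuis S U y).
rewrite /nijenhuis !linearB linear0 /= !lee_lie !leeJ J_lee_vector.
rewrite (anti_lee_lie_ker anti_lee_U etaJy).
by rewrite opprK !oppr0 !add0r addr0.
Qed.

Lemma h_ideal : is_ideal h.
Proof.
move=> x y yh; apply/mem_hP; split; first exact: lee_lie.
have /mem_hP[thy etay] := yh.
have [a [z [-> etaz]]] : exists a z, x = z + a *: V /\ eta z = 0.
  exists (eta x), (x - eta x *: V); rewrite subrK; split=> //.
  by rewrite raddfB /= linearZ /= anti_lee_V [_ *: 1]mulr1 subrr.
rewrite lieDl lieZl linearD linearZ /= anti_lee_lie_V // scaler0 addr0.
exact: anti_lee_lie_ker.
Qed.

(** The component [W] of [[U, V]] in [h] is detected by [Omega (W, z)] for [z]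
    in [h], and [d Omega = theta /\ Omega] on [U], [V], [z] says that this is
    zero: [[V, z]] and [[z, U]] are in [h], hence [Omega]-orthogonal to [U] and
    [V]. *)
Lemma lie_lee_anti_lee : [lie U, V] = eta [lie U, V] *: V.
Proof.
set c := eta _; pose W := [lie U, V] - c *: V.
have Wh : W \in h.
  have := sub_projection_mem_h [lie U, V].
  by rewrite lee_lie scale0r add0r.
have gW z : z \in h -> g W (J z) = 0.
  move=> zh; have := lck_dOmega S U V z.
  have /mem_hP[thz etaz] := zh; have /mem_hP[thJz etaJz] := hJ zh.
  rewrite /ce_d2 /wedge12 /fundamental_form lee_V thz !mul0r !addr0.
  rewrite anti_lee_vectorE etaJz mulr0 J_lee_vector J_anti_lee_vector.
  rewrite (metricC g _ V) anti_lee_vectorE anti_lee_lie_V // subr0.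
  rewrite linearNr /= (metricC g _ U) lee_vectorE lee_lie oppr0 subr0.
  move/eqP; rewrite oppr_eq0 => /eqP gUV.
  rewrite /W linearBl /= linearZl_LR /= anti_lee_vectorE gUV etaJz.
  by rewrite mulr0 subr0.
suff W0 : W = 0 by apply/eqP; rewrite -subr_eq0; apply/eqP.
apply: (metric_eq0 (g := g)); apply/eqP; rewrite -oppr_eq0 -linearNr /=.
by rewrite -(lck_JJ S) gW // hJ.
Qed.

Lemma K_subalgebra : is_subalgebra K.
Proof.
move=> _ _ /memK_comb[a [b ->]] /memK_comb[c [d ->]].
rewrite !(lieDl, lieDr, lieZl, lieZr) !liexx (lieC V U) lie_lee_anti_lee -scaleNr.
by rewrite !(memvD, memvZ, mem0v, anti_lee_vector_in_K).
Qed.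

End IntegrableLCK.

Theorem corollary4p2 (R : realType) (n : nat) (hn : (1 <= n)%N)
    (g : lieAlgType R) (dim_g : \dim {: g} = (2 * n + 2)%N)
    (S : lck_structure g)
    (lee_unit : conorm (lck_metric S) (lee_form S) = 1)
    (integrableS : lck_integrable S) :
  let U := lee_vector S in
  let V := anti_lee_vector S in
  let K := <<[:: U; V]>>%VS in
  let h := orthov (lck_metric S) K in
  exists (subK : is_subalgebra K) (idh : is_ideal h)
         (rho : der_hom (subalgebra_of subK)
                        (subalgebra_of (ideal_subalgebra idh))),
    [/\ forall x, vsval (rho (vsproj K U) x) = [lie U, vsval x],
        forall x, vsval (rho (vsproj K V) x) = [lie V, vsval x]
      & lie_isomorphic g (semidirect rho)].
Proof.
move=> U V K h.
pose subK := K_subalgebra lee_unit integrableS.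
pose idh := h_ideal lee_unit integrableS.
exists subK, idh, (adjoint_action subK idh); split=> [x | x |].
- by apply: adjoint_actionE; apply: lee_vector_in_K.
- by apply: adjoint_actionE; apply: anti_lee_vector_in_K.
- apply: isomorphic_semidirect; first exact: capv_orthov.
  exact: addv_Kh.
Qed.
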